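(* For every finite poset $P$ there is an integer $n_0$ such that for every $n>n_0$ the following holds. If $P$ contains a copy of $\Lambda$ or a copy of $V$, then $R(P,Q_n)\ge n+\frac{1}{15}\cdot\frac{n}{\log n}$. If $P$ contains neither a copy of $\Lambda$ nor a copy of $V$, then $R(P,Q_n)\le n+f(P)$, where $f(P)$ is a quantity depending only on $P$ (not on $n$).
   Context: A poset $P_1$ is an induced subposet of $P_2$ if $P_1\subseteq P_2$ and for $X_1,X_2\in P_1$, $X_1\le_{P_1}X_2$ iff $X_1\le_{P_2}X_2$. A copy of $P_1$ in $P_2$ is an induced subposet of $P_2$ isomorphic to $P_1$. $Q_n$ denotes the Boolean lattice of all subsets of an $n$-element set ordered by inclusion. For posets $P,Q$, the poset Ramsey number $R(P,Q)$ is the least $N\in\mathbb{N}$ such that every coloring of the elements of $Q_N$ with blue and red contains a copy of $P$ all of whose elements are blue or a copy of $Q$ all of whose elements are red. $\Lambda$ is the poset on three elements $Z_1,Z_2,Z_3$ with $Z_1<Z_3$, $Z_2<Z_3$ and $Z_1,Z_2$ incomparable; $V$ is the poset on $Z_1,Z_2,Z_3$ with $Z_1>Z_3$, $Z_2>Z_3$ and $Z_1,Z_2$ incomparable. $\log$ denotes the logarithm to base $2$. *)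

(* Defs.v *)
From HB Require Import structures.
From mathcomp Require Import all_boot all_order all_algebra.
From mathcomp Require Import reals exp.

Set Implicit Arguments.
Unset Strict Implicit.
Unset Printing Implicit Defensive.

Import Order.TTheory Order.DefaultSetSubsetOrder.
Local Open Scope order_scope.

(* The library order on [{set 'I_n}] is inclusion. *)
Definition Qn (n : nat) := {set 'I_n}.
HB.instance Definition _ n := Order.FinPOrder.on (Qn n).

(* [f] is an order isomorphism from [P1] onto the subposet of [P2] induced by
   [A]; it is injective because it reflects the order. *)
Definition copy d1 d2 (P1 : finPOrderType d1) (P2 : finPOrderType d2)
    (A : {set P2}) : bool :=
  [exists f : {ffun P1 -> P2},
    [forall x, forall y, (f x <= f y) == (x <= y)] &&
    (f @: [set: P1] == A)].

Definition contains_copy d1 d2 (P1 : finPOrderType d1)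
    (P2 : finPOrderType d2) : bool :=
  [exists A : {set P2}, copy P1 A].

(* Colour [true] is blue, colour [false] is red. *)
Definition ramsey_arrow dP dQ (P : finPOrderType dP) (Q : finPOrderType dQ)
    (N : nat) : bool :=
  [forall c : {ffun Qn N -> bool},
    [exists A : {set Qn N}, copy P A && [forall X in A, c X == true]] ||
    [exists A : {set Qn N}, copy Q A && [forall X in A, c X == false]]].

Lemma copy_imset d1 d2 (P1 : finPOrderType d1) (P2 : finPOrderType d2)
    (f : P1 -> P2) : {mono f : x y / x <= y} -> copy P1 (f @: [set: P1]).
Proof.
move=> fm; apply/existsP; exists [ffun x => f x]; apply/andP; split.
  by apply/forallP=> x; apply/forallP=> y; rewrite !ffunE fm.
by apply/eqP/eq_imset => x; rewrite ffunE.
Qed.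

(* The ground set is [P] together with disjoint copies of [Q] indexed by
   possible ranks; every [p] owns a copy of [Q] in the Boolean lattice, and
   these copies are nested along [P]. *)
Lemma ramsey_arrow_ex dP dQ (P : finPOrderType dP) (Q : finPOrderType dQ) :
  exists N, ramsey_arrow P Q N.
Proof.
pose T : finType := (P + 'I_#|P|.+1 * Q)%type.
pose r (p : P) := #|[set q | q < p]|.
have r_lt p p' : p < p' -> (r p < r p')%N.
  move=> pp'; apply: proper_card; apply/properP; split.
    by apply/subsetP=> q; rewrite !inE => /lt_trans; apply.
  by exists p; rewrite !inE ?ltxx.
pose B p y (t : T) := match t with
  | inl q => q <= p
  | inr (j, y') => (j < r p)%N || ((j == r p :> nat) && (y' <= y)) end.
pose E p y : Qn #|T| := [set i | B p y (enum_val i)].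
have in_E p y t : (enum_rank t \in (E p y : {set 'I_#|T|})) = B p y t.
  by rewrite inE enum_rankK.
have rP p : (r p < #|P|.+1)%N by rewrite ltnS max_card.
have EQ p : {mono E p : x y / x <= y}.
  move=> x y; apply/subsetP/idP => [sE | xy i].
    have := sE (enum_rank (inr (Ordinal (rP p), x) : T)).
    by rewrite !in_E /= ltnn eqxx lexx; apply.
  rewrite !inE; case: (enum_val i) => [//|[j y'] /=] /orP[-> //|/andP[-> /=]].
  by move/le_trans=> -> //; rewrite orbT.
have EP (h : P -> Q) : {mono (fun p => E p (h p)) : x y / x <= y}.
  move=> x y; apply/subsetP/idP => [sE | ].
    by have := sE (enum_rank (inl x : T)); rewrite !in_E /= lexx; apply.
  rewrite le_eqVlt => /predU1P[-> //|xy] i; rewrite !inE.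
  case: (enum_val i) => [q /=|[j y'] /=]; first by move/le_trans; apply; apply: ltW.
  case/orP=> [jx|/andP[/eqP-> _]]; last by rewrite r_lt.
  by rewrite (ltn_trans jx) // r_lt.
exists #|T|; apply/forallP=> c; apply/orP.
case: (boolP [exists p, forall y, c (E p y) == false]) => [/existsP[p /forallP cp]|].
  right; apply/existsP; exists (E p @: [set: Q]); rewrite copy_imset //=.
  by apply/forall_inP=> _ /imsetP[y _ ->].
rewrite negb_exists => /forallP nred; left.
have /fin_all_exists[h ch] p : exists y, c (E p y).
  by have := nred p; rewrite negb_forall => /existsP[y]; rewrite eqbF_neg negbK; exists y.
apply/existsP; exists ((fun p => E p (h p)) @: [set: P]); rewrite copy_imset //=.
by apply/forall_inP=> _ /imsetP[p _ ->]; rewrite ch.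
Qed.

Definition poset_ramsey dP dQ (P : finPOrderType dP)
    (Q : finPOrderType dQ) : nat :=
  ex_minn (ramsey_arrow_ex P Q).

(* On ['I_3] the values 0, 1, 2 stand for Z1, Z2, Z3. *)
Definition Lambda_poset := 'I_3.
HB.instance Definition _ := Finite.on Lambda_poset.

Definition Lambda_le (x y : Lambda_poset) : bool :=
  (x == y) || (y == ord_max :> 'I_3).

Fact Lambda_le_refl : reflexive Lambda_le.
Proof. by move=> x; rewrite /Lambda_le eqxx. Qed.
Fact Lambda_le_anti : antisymmetric Lambda_le.
Proof.
by move=> x y /andP[/predU1P[-> //|/eqP->] /predU1P[-> //|/eqP->]].
Qed.
Fact Lambda_le_trans : transitive Lambda_le.
Proof.
by move=> y x z /predU1P[-> //|/eqP-> /predU1P[<-|/eqP->]];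
  rewrite /Lambda_le eqxx orbT.
Qed.
HB.instance Definition _ := Order.Le_isPOrder.Build (Order.Disp tt tt)
  Lambda_poset Lambda_le_refl Lambda_le_anti Lambda_le_trans.

Definition V_poset := 'I_3.
HB.instance Definition _ := Finite.on V_poset.

Definition V_le (x y : V_poset) : bool :=
  (x == y) || (x == ord_max :> 'I_3).

Fact V_le_refl : reflexive V_le.
Proof. by move=> x; rewrite /V_le eqxx. Qed.
Fact V_le_anti : antisymmetric V_le.
Proof.
by move=> x y /andP[/predU1P[-> //|/eqP->] /predU1P[-> //|/eqP->]].
Qed.
Fact V_le_trans : transitive V_le.
Proof.
by move=> y x z /predU1P[-> //|/eqP-> _]; rewrite /V_le eqxx orbT.
Qed.
HB.instance Definition _ := Order.Le_isPOrder.Build (Order.Disp tt tt)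
  V_poset V_le_refl V_le_anti V_le_trans.

Definition log2 (R : realType) (x : R) : R := (ln x / ln 2)%R.

(* Main.v *)
(* Lower bound.  Let [N = n + k].  A copy [f] of [Q_n] in [Q_N] determines
   distinct points [x_i] with [x_i \in f S] iff [i \in S]; let [Y] be the set of
   the remaining [k] points.  Suppose that for each [k]-set [Y] and each sequence
   [s] of distinct points of [Y] there is a blue set [node Y s] whose trace on [Y]
   is [s] and which grows when [s] is extended.  Starting from [s = [::]], if [f]
   misses [node Y s] then [f] at the trace of [node Y s] contains a point of [Y]
   outside [s], by which [s] can be extended; this cannot go on for more than [k]
   steps, so [f] meets a blue set.  If moreover [node Y s] is contained in
   [node Y' s'] only when [Y = Y'] and [s] is a prefix of [s'], then the blue sets
   form a forest, which contains no Lambda.  To ensure this, [node Y s] also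
   contains a Reed-Solomon codeword of [Y], robust against the deletion of the
   at most [2 k] points of [Y] and [Y'], and the binary codes of the entries of [s]
   written outside [Y]; this takes [8 k log N] points.  Complementing handles V.

   Upper bound.  Without Lambda and V, [P] is a parallel composition of chains.
   Sublattices of [Q_N] sitting above the members of an antichain are mutually
   incomparable, and each contains a blue chain of length [#|P|] or a red [Q_n]. *)

Require Import Defs.
From mathcomp Require Import all_boot all_order all_algebra all_field.
From mathcomp Require Import boolp reals exp.
From mathcomp Require Import zify.

Set Implicit Arguments.
Unset Strict Implicit.
Unset Printing Implicit Defensive.

Import Order.TTheory Order.DefaultSetSubsetOrder.

(** * Copies and arrows in terms of order embeddings *)

Lemma colored_copyP d (P : finPOrderType d) N (p : pred {set 'I_N}) :
  reflect (exists2 f : P -> {set 'I_N},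
             (forall x y, (f x \subset f y) = (x <= y)%O) & forall x, p (f x))
    [exists A : {set Qn N}, copy P A && [forall X in A, p X]].
Proof.
apply: (iffP existsP) => [[A /andP[/existsP[f /andP[fm /eqP fA]] /forall_inP pA]]|].
  exists f => [x y|x]; last by apply: pA; rewrite -fA imset_f.
  by move/forallP/(_ x)/forallP/(_ y)/eqP: fm.
case=> f fm pf; exists ((f : P -> Qn N) @: [set: P]).
apply/andP; split; first by apply: copy_imset => x y; exact: fm.
by apply/forall_inP => _ /imsetP[x _ ->]; exact: pf.
Qed.

Lemma ramsey_arrowP dP dQ (P : finPOrderType dP) (Q : finPOrderType dQ) N :
  reflect (forall c : pred {set 'I_N},
    (exists2 f : P -> {set 'I_N},
       (forall x y, (f x \subset f y) = (x <= y)%O) & forall x, c (f x)) \/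
    (exists2 f : Q -> {set 'I_N},
       (forall x y, (f x \subset f y) = (x <= y)%O) & forall x, ~~ c (f x)))
  (ramsey_arrow P Q N).
Proof.
apply: (iffP forallP) => H c.
  have /orP[/colored_copyP[f fm fc]|/colored_copyP[f fm fc]] := H [ffun X : Qn N => c X].
    by left; exists f => // x; have := fc x; rewrite ffunE eqb_id.
  by right; exists f => // x; have := fc x; rewrite ffunE eqbF_neg.
apply/orP; case: (H c) => -[f fm fc]; [left|right]; apply/colored_copyP; exists f => // x.
  by rewrite eqb_id.
by rewrite eqbF_neg.
Qed.

Lemma contains_copyP d1 d2 (P1 : finPOrderType d1) (P2 : finPOrderType d2) :
  reflect (exists f : P1 -> P2, {mono f : x y / (x <= y)%O}) (contains_copy P1 P2).
Proof.
apply: (iffP existsP) => [[A /existsP[f /andP[fm _]]]|[f fm]].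
  by exists f => x y; move/forallP/(_ x)/forallP/(_ y)/eqP: fm.
by exists (f @: [set: P1]); exact: copy_imset.
Qed.

Definition ord3_fun T (a b c : T) (i : 'I_3) : T :=
  match val i with 0 => a | 1 => b | _ => c end.

Lemma contains_LambdaP d (P : finPOrderType d) :
  reflect (exists u v w : P, [/\ (u <= w)%O, (v <= w)%O & ~~ (u >=< v)%O])
    (contains_copy Lambda_poset P).
Proof.
apply: (iffP (contains_copyP _ _)) => [[f fm]|[u [v [w [uw vw]]]]].
  exists (f (inord 0)), (f (inord 1)), (f ord_max).
  by rewrite /Order.comparable !fm; split;
    rewrite /Order.le /= /Lambda_le -!val_eqE /= !inordK.
rewrite negb_or => /andP[uv vu].
have wu : ~~ (w <= u)%O by apply: contraNN vu => /(le_trans vw).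
have wv : ~~ (w <= v)%O by apply: contraNN uv => /(le_trans uw).
exists (ord3_fun u v w) => -[[|[|[|//]]] i] [[|[|[|//]]] j];
  rewrite /ord3_fun /= ?lexx; [by []|..].
- exact: negbTE.
- exact: uw.
- exact: negbTE.
- by [].
- exact: vw.
- exact: negbTE.
- exact: negbTE.
- by [].
Qed.

Lemma contains_VP d (P : finPOrderType d) :
  reflect (exists u v w : P, [/\ (w <= u)%O, (w <= v)%O & ~~ (u >=< v)%O])
    (contains_copy V_poset P).
Proof.
apply: (iffP (contains_copyP _ _)) => [[f fm]|[u [v [w [wu wv]]]]].
  exists (f (inord 0)), (f (inord 1)), (f ord_max).
  by rewrite /Order.comparable !fm; split;
    rewrite /Order.le /= /V_le -!val_eqE /= !inordK.
rewrite negb_or => /andP[uv vu].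
have uw : ~~ (u <= w)%O by apply: contraNN uv => /le_trans; apply.
have vw : ~~ (v <= w)%O by apply: contraNN vu => /le_trans; apply.
exists (ord3_fun u v w) => -[[|[|[|//]]] i] [[|[|[|//]]] j];
  rewrite /ord3_fun /= ?lexx; [by []|..].
- exact: negbTE.
- exact: negbTE.
- exact: negbTE.
- by [].
- exact: negbTE.
- exact: wu.
- exact: wv.
- by [].
Qed.

(** * Upper bound: layered colorings and parallel chains *)

Section Layers.
Variables (X : finType) (c : {set X} -> nat -> bool).

(* [reach S i]: a blue chain visits the layers [0, ..., i - 1] below [S]. *)
Fixpoint reach (S : {set X}) (i : nat) : bool :=
  if i is j.+1 then [exists A : {set X}, [&& A \subset S, c A j & reach A j]]
  else true.

Lemma reach_sub (S S' : {set X}) i : S \subset S' -> reach S i -> reach S' i.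
Proof.
case: i => //= i SS' /existsP[A /and3P[AS cA rA]]; apply/existsP; exists A.
by rewrite (subset_trans AS) ?cA.
Qed.

Lemma reach_chain (S : {set X}) t : reach S t ->
  exists g : nat -> {set X},
    [/\ forall i, i < t -> g i \subset S, forall i, i < t -> c (g i) i
      & forall i j, i <= j < t -> g i \subset g j].
Proof.
elim: t S => [|t IH] S; first by exists (fun=> S); split => // i j /andP[_].
case/existsP=> A /and3P[AS cA /IH[g [gA gc gm]]].
exists (fun i => if i < t then g i else A); split => [i|i|i j].
- by case: ifP => // it _; exact: subset_trans (gA _ it) AS.
- by case: ifP => [/gc //|it] ?; have -> : i = t by lia.
- move=> ijt; case: ifP => it; case: ifP => jt //; first by apply: gm; lia.
    exact: gA.
  by lia.
Qed.

(** Without a blue chain through all [t] layers, let [h A] be the largest [i] with [reach A i]. It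
    is monotone in [A], and [A] is red in layer [h A], since otherwise [A] itself would extend the
    chain. *)
Lemma chain_or_layering t :
  (exists2 g : nat -> {set X}, forall i, i < t -> c (g i) i
      & forall i j, i <= j < t -> g i \subset g j) \/
  (exists2 h : {set X} -> nat, {homo h : A B / A \subset B >-> A <= B}
      & forall A, h A < t /\ ~~ c A (h A)).
Proof.
case: (boolP (reach setT t)) => [/reach_chain[g [_ gc gm]]|nr]; first by left; exists g.
have t0 : 0 < t by case: t nr.
right; exists (fun S => \max_(i < t | reach S i) i) => [A B AB|A].
  by apply/bigmax_leqP => i ri; apply: leq_bigmax_cond; exact: reach_sub ri.
have [|i ri Mi] := @eq_bigmax_cond _ [pred i : 'I_t | reach A i] (@nat_of_ord t).
  by apply/card_gt0P; exists (Ordinal t0).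
rewrite Mi; split=> //; apply: contraNN nr => cA.
have rS : reach A i.+1 by apply/existsP; exists A; rewrite subxx cA.
case: (ltngtP i.+1 t) => [it||<-]; last exact: reach_sub rS.
- have := @leq_bigmax_cond _ [pred i : 'I_t | reach A i] (@nat_of_ord t) (Ordinal it) rS.
  by rewrite Mi /= ltnn.
- by have := ltn_ord i; lia.
Qed.

End Layers.

Lemma arrow_parallel_chains d (P : finPOrderType d) n :
  ~~ contains_copy Lambda_poset P -> ~~ contains_copy V_poset P ->
  ramsey_arrow P (Qn n) (n + (#|{set P}| + #|P|)).
Proof.
move=> /contains_LambdaP nL /contains_VP nV.
have cmpU (u v w : P) : (u <= w)%O -> (v <= w)%O -> (u >=< v)%O.
  by move=> uw vw; apply/negP => /negP uv; apply: nL; exists u, v, w.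
have cmpD (u v w : P) : (w <= u)%O -> (w <= v)%O -> (u >=< v)%O.
  by move=> uw vw; apply/negP => /negP uv; apply: nV; exists u, v, w.
(* Comparability is thus an equivalence whose classes are chains; [comp x] names the class of [x]
   and [r x] its height there. *)
have cmp_trans (u v w : P) : (u >=< v)%O -> (v >=< w)%O -> (u >=< w)%O.
  case/orP=> uv /orP[] vw.
  - by rewrite /Order.comparable (le_trans uv).
  - exact: cmpU uv vw.
  - exact: cmpD uv vw.
  - by rewrite comparable_sym /Order.comparable (le_trans vw).
pose comp (x : P) := [set y | (x >=< y)%O].
pose r (x : P) := #|[set y | (y < x)%O]|.
have r_lt (x y : P) : (x < y)%O -> r x < r y.
  move=> xy; apply: proper_card; apply/properP; split.
    by apply/subsetP=> q; rewrite !inE => /lt_trans; apply.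
  by exists x; rewrite !inE ?ltxx.
have r_max x : r x < #|P|.
  rewrite /r -cardsT; apply: proper_card; apply/properP; split; first exact: subsetT.
  by exists x; rewrite !inE ?ltxx.
have le_comp (x y : P) : (x <= y)%O = (comp x == comp y) && (r x <= r y).
  apply/idP/andP => [xy|[/eqP exy rxy]].
    split; last by move: xy; rewrite le_eqVlt => /predU1P[-> //|/r_lt/ltnW].
    apply/eqP/setP=> z; rewrite !inE; have cxy : (x >=< y)%O by rewrite /Order.comparable xy.
    by apply/idP/idP; apply: cmp_trans; rewrite // comparable_sym.
  have : y \in comp x by rewrite exy inE comparablexx.
  by rewrite inE => /comparable_leP[//|/r_lt]; rewrite ltnNge rxy.
(* The three summands carry a member of [Q_n], a singleton label that makes different classes
   incomparable, and a level stored as an initial segment. *)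
pose T : finType := ('I_n + ({set P} + 'I_#|P|))%type.
have <- : #|T| = n + (#|{set P}| + #|P|) by rewrite !card_sum !card_ord.
pose mem_emb j (S : {set 'I_n}) i (t : T) := match t with
  | inl x => x \in S | inr (inl j') => j' == j | inr (inr y) => y < i end.
pose emb j S i : {set 'I_#|T|} := [set z | mem_emb j S i (enum_val z)].
have embE j S i j' S' i' : i <= #|P| ->
    (emb j S i \subset emb j' S' i') = [&& S \subset S', j == j' & i <= i'].
  move=> iP; apply/subsetP/and3P => [sub|[SS' /eqP-> ii'] z].
    have subT (z : T) : enum_rank z \in emb j S i -> enum_rank z \in emb j' S' i' by exact: sub.
    split.
    - by apply/subsetP => x xS; have := subT (inl x); rewrite !inE !enum_rankK; apply.
    - by have := subT (inr (inl j)); rewrite !inE !enum_rankK /= eqxx; apply.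
    - case: i iP subT {sub} => // i iP /(_ (inr (inr (Ordinal iP)))).
      by rewrite !inE !enum_rankK /=; apply.
  rewrite !inE; case: (enum_val z) => [x /(subsetP SS')//|[//|y] yi].
  exact: leq_trans yi ii'.
apply/ramsey_arrowP => c.
have [[j [h hm hr]]|nred] := pselect (exists j, exists2 h : {set 'I_n} -> nat,
    {homo h : A B / A \subset B >-> A <= B} & forall A, h A < #|P| /\ ~~ c (emb j A (h A))).
  (* The graph of the monotone [h] is a red copy of [Q_n]. *)
  right; exists (fun A : Qn n => emb j A (h A)) => [A B|A]; last by case: (hr A).
  rewrite embE ?eqxx /=; last by case: (hr A) => /ltnW.
  by apply: andb_idr; exact: hm.
left.
have /fin_all_exists[g gP] j : exists g : nat -> {set 'I_n},
    (forall i, i < #|P| -> c (emb j (g i) i)) /\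
    (forall i i', i <= i' < #|P| -> g i \subset g i').
  have [[g gc gm]|red] := chain_or_layering (fun A => c \o emb j A) #|P|.
    by exists g.
  by case: nred; exists j.
exists (fun x => emb (comp x) (g (comp x) (r x)) (r x)) => [x y|x].
  rewrite embE ?(ltnW (r_max _)) // le_comp.
  apply: andb_idl => /andP[/eqP-> rxy]; apply: (gP _).2; by rewrite rxy r_max.
by apply: (gP _).1; exact: r_max.
Qed.

(** * Separating words from polynomials over a finite field *)

Lemma exists_inj_in (T U : finType) (A : {set U}) : #|T| <= #|A| ->
  exists2 e : T -> U, injective e & forall x, e x \in A.
Proof.
move=> le; exists (fun x => enum_val (widen_ord le (enum_rank x))) => [x y|x].
  by move=> /enum_val_inj/(congr1 val)/= /val_inj/enum_rank_inj.
exact: enum_valP.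
Qed.

Lemma exists_inj (T U : finType) : #|T| <= #|U| -> exists e : T -> U, injective e.
Proof. by rewrite -[#|U|]cardsT => /exists_inj_in[e einj _]; exists e. Qed.

Section SetPoly.
Local Open Scope ring_scope.
Import GRing.Theory.
Variables (Z : finType) (F : fieldType) (g : Z -> F).

Definition set_poly (Y : {set Z}) : {poly F} := \prod_(y <- enum Y) ('X - (g y)%:P).

Lemma set_poly_inj : injective g -> injective set_poly.
Proof.
move=> ginj Y Y' eq; apply/setP => z.
have rootE A : root (set_poly A) (g z) = (z \in A).
  by rewrite /set_poly -(big_map g predT (fun a => 'X - a%:P)) root_prod_XsubC
             mem_map // mem_enum.
by rewrite -!rootE eq.
Qed.

(** Both polynomials are monic of the same degree, so the leading terms cancel. *)
Lemma size_set_polyB (Y Y' : {set Z}) :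
  #|Y| = #|Y'| -> (size (set_poly Y - set_poly Y')%R <= #|Y|)%N.
Proof.
move=> eqY; have sE A : size (set_poly A) = #|A|.+1 by rewrite size_prod_XsubC -cardE.
apply/leq_sizeP => i; rewrite leq_eqVlt coefB => /predU1P[<-|lt].
  have lE A : (set_poly A)`_#|A| = 1.
    by have /monicP := monic_prod_XsubC (enum A) predT g; rewrite /lead_coef sE.
  by rewrite lE eqY lE subrr.
by rewrite !nth_default ?subrr // sE -?eqY.
Qed.

End SetPoly.

(** Evaluate [set_poly g Y] at [3 * k] points of the field with [2 ^ m] elements. Two such
    polynomials differ by a nonzero one with fewer than [k] roots, so the words agree in fewer than
    [k] positions. *)
Lemma separating_words (Z : finType) k m :
  0 < m -> #|Z| <= 2 ^ m -> 3 * k <= 2 ^ m ->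
  exists w : {set Z} -> 'I_(3 * k) -> {ffun 'I_m -> bool},
    forall Y Y' : {set Z}, #|Y| = k -> #|Y'| = k -> Y != Y' ->
    2 * k < #|[set t | w Y t != w Y' t]|.
Proof.
move=> m0 Zm km; have [F _ cF] := pPrimePowerField (isT : prime 2) m0.
rewrite -cF in Zm; have [g ginj] := exists_inj Zm.
have [|p pinj] := @exists_inj 'I_(3 * k) F; first by rewrite card_ord cF.
have [|b binj] := @exists_inj F {ffun 'I_m -> bool}.
  by rewrite card_ffun card_bool card_ord cF.
exists (fun Y t => b ((set_poly g Y).[p t])%R) => Y Y' cY cY' neq.
set D := [set t | _]; set q := (set_poly g Y - set_poly g Y')%R.
have q0 : q != 0%R.
  by rewrite GRing.subr_eq0; apply: contraNN neq => /eqP/(set_poly_inj ginj)->.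
have /(max_poly_roots q0) : all (root q) [seq p t | t <- enum (~: D)].
  apply/allP => _ /mapP[t tD ->]; move: tD.
  by rewrite mem_enum !inE negbK => /eqP/binj e; rewrite /root hornerD hornerN e GRing.subrr.
rewrite map_inj_uniq ?enum_uniq // size_map -cardE => /(_ isT).
have := size_set_polyB g (etrans cY (esym cY')); rewrite -/q cY.
move=> sq /leq_trans /(_ sq) lt; have cD := cardsC D; rewrite card_ord in cD.
by move: #|D| #|~: D| lt cD => a a'; lia.
Qed.

(** * Lower bound: the blue forest *)

Lemma prefix_take (T : eqType) (s1 s2 : seq T) (x0 : T) :
  size s1 <= size s2 -> (forall i, i < size s1 -> nth x0 s1 i = nth x0 s2 i) ->
  s1 = take (size s1) s2.
Proof.
move=> le eq; apply: (@eq_from_nth _ x0); first by rewrite size_takel.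
by move=> i i1; rewrite nth_take // eq.
Qed.

Section Forest.
Variables N k m : nat.
Hypothesis m_gt0 : 0 < m.
Let sym : finType := ('I_m * bool)%type.
Implicit Types (Y : {set 'I_N}) (s : seq 'I_N).
Variables (w : {set 'I_N} -> 'I_(3 * k) -> {ffun 'I_m -> bool}).
Hypothesis w_sep : forall Y Y' : {set 'I_N}, #|Y| = k -> #|Y'| = k -> Y != Y' ->
  2 * k < #|[set t | w Y t != w Y' t]|.
Variable b : 'I_N -> {ffun 'I_m -> bool}.
Hypothesis b_inj : injective b.
Variable e1 : 'I_(3 * k) * sym -> 'I_N.
Hypothesis e1_inj : injective e1.
Variable e2 : {set 'I_N} -> 'I_k * sym -> 'I_N.
Hypothesis e2_inj : forall Y : {set 'I_N}, #|Y| = k -> injective (e2 Y).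
Hypothesis e2_notin : forall (Y : {set 'I_N}) x, #|Y| = k -> e2 Y x \notin Y.
Hypothesis e2_e1 : forall (Y : {set 'I_N}) x y, #|Y| = k -> e2 Y x != e1 y.

(* A word is written one-hot, bit by bit, so that the sets of two different
   words are incomparable. *)
Definition code_part (Y : {set 'I_N}) : {set 'I_N} :=
  e1 @: [set x : 'I_(3 * k) * sym | w Y x.1 x.2.1 == x.2.2].

(** Slot [i] stays empty until [s] has more than [i] entries, so extending [s] only adds points,
    while the filled slots record the order of the entries. *)
Definition block_part (Y : {set 'I_N}) (s : seq 'I_N) : {set 'I_N} :=
  e2 Y @: [set x : 'I_k * sym | (x.1 < size s) &&
                   (nth [ffun=> false] (map b s) x.1 x.2.1 == x.2.2)].

Definition node (Y : {set 'I_N}) (s : seq 'I_N) : {set 'I_N} :=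
  (code_part Y :\: Y) :|: [set y in s] :|: block_part Y s.

Lemma node_cat Y s s' : node Y s \subset node Y (s ++ s').
Proof.
rewrite /node; apply: setUSS; first apply: setUS.
  by apply/subsetP => z; rewrite !inE mem_cat => ->.
apply: imsetS; apply/subsetP => x; rewrite !inE size_cat map_cat nth_cat size_map.
by case/andP=> xs nx; rewrite xs nx ltn_addr.
Qed.

Lemma node_base Y s y : #|Y| = k -> y \in Y -> (y \in node Y s) = (y \in s).
Proof.
move=> cY yY; rewrite !inE yY /=; apply/orb_idr => /imsetP[x _ yx].
by move: yY; rewrite yx (negbTE (e2_notin _ cY)).
Qed.

Lemma code_node Y s x : #|Y| = k -> {subset s <= Y} -> e1 x \notin Y ->
  (e1 x \in node Y s) = (w Y x.1 x.2.1 == x.2.2).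
Proof.
move=> cY sY xY; rewrite !inE xY /= mem_imset // inE.
rewrite (negbTE (contra (sY _) xY)) orbF.
by apply/orb_idr => /imsetP[y _ /esym/eqP]; rewrite (negbTE (e2_e1 _ _ cY)).
Qed.

Lemma block_node Y s x : #|Y| = k -> {subset s <= Y} ->
  (e2 Y x \in node Y s) =
  (x.1 < size s) && (nth [ffun=> false] (map b s) x.1 x.2.1 == x.2.2).
Proof.
move=> cY sY; rewrite !inE mem_imset ?inE; last exact: e2_inj.
rewrite (negbTE (contra (sY _) (e2_notin x cY))) e2_notin //= orbF.
apply/orb_idl => /imsetP[y _ /eqP]; by rewrite (negbTE (e2_e1 _ _ cY)).
Qed.

(** Each position where the two words differ gives a point coded for [Y] and not for [Y']. Inclusion
    forces these more than [2 * k] points into the union of [Y] and [Y'], which is too small. *)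
Lemma node_root Y Y' s s' : #|Y| = k -> #|Y'| = k ->
  {subset s <= Y} -> {subset s' <= Y'} -> node Y s \subset node Y' s' -> Y = Y'.
Proof.
move=> cY cY' sY sY' sub; apply/eqP; apply/negPn/negP => neq.
have := w_sep cY cY' neq; set D := [set t | _]; apply/negP; rewrite -leqNgt.
have /fin_all_exists[j jP] t : exists j, t \in D -> w Y t j != w Y' t j.
  case: (boolP (t \in D)) => [|_]; last by exists (Ordinal m_gt0).
  rewrite inE => neqt; have /existsP[j jP] : [exists j, w Y t j != w Y' t j].
    rewrite -negb_forall; apply: contraNN neqt => /forallP eq.
    by apply/eqP/ffunP => j; apply/eqP.
  by exists j.
pose z t := e1 (t, (j t, w Y t (j t))).
have zinj : injective z by move=> t t' /e1_inj[].
rewrite -(card_imset D zinj).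
have /subset_leq_card/leq_trans -> // : z @: D \subset Y :|: Y'; last first.
  by have := leq_card_setU Y Y'; rewrite cY cY' => /leq_trans -> //; lia.
apply/subsetP => _ /imsetP[t tD ->]; rewrite inE.
case: (boolP (z t \in Y)) => //= zY; apply/negPn/negP => zY'.
have : z t \in node Y s by rewrite code_node.
move/(subsetP sub); rewrite code_node //= eq_sym; apply/negP; exact: jP.
Qed.

Lemma node_prefix Y s s' : #|Y| = k -> uniq s ->
  {subset s <= Y} -> {subset s' <= Y} -> node Y s \subset node Y s' ->
  s = take (size s) s'.
Proof.
move=> cY us sY sY' sub.
have sk : size s <= k by rewrite -cY cardE; apply: uniq_leq_size => // y /sY; rewrite mem_enum.
have H i (j : 'I_m) : i < size s -> i < size s' /\
    nth [ffun=> false] (map b s) i j = nth [ffun=> false] (map b s') i j.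
  move=> lti; pose x : 'I_k * sym :=
    (Ordinal (leq_trans lti sk), (j, nth [ffun=> false] (map b s) i j)).
  have : e2 Y x \in node Y s by rewrite block_node //= lti eqxx.
  by move/(subsetP sub); rewrite block_node //= => /andP[-> /eqP->].
apply: (inj_map b_inj); rewrite map_take -(size_map b s).
apply: (@prefix_take _ _ _ [ffun=> false]); rewrite !size_map.
  case e: (size s) => // [l].
  by have [|] := H l (Ordinal m_gt0); rewrite ?e.
by move=> i /H H'; apply/ffunP => j; case: (H' j).
Qed.

Definition forest (A : {set 'I_N}) : Prop :=
  exists Y s, [/\ #|Y| = k, uniq s, {subset s <= Y} & A = node Y s].

(** [A] and [B] share the root of [C], and their sequences are prefixes of the same sequence, so one
    is a prefix of the other. *)
Lemma forest_down A B C : forest A -> forest B -> forest C ->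
  A \subset C -> B \subset C -> (A \subset B) || (B \subset A).
Proof.
move=> [Y [s [cY us sY ->]]] [Y' [s' [cY' us' sY' ->]]] [X [r [cX ur rX ->]]] sub sub'.
have eY := node_root cY cX sY rX sub; have eY' := node_root cY' cX sY' rX sub'.
rewrite {}eY {}eY' in sY sY' sub sub' *.
have es := node_prefix cX us sY rX sub; have es' := node_prefix cX us' sY' rX sub'.
wlog le : s s' us us' sY sY' sub sub' es es' / size s <= size s'.
  by move=> W; case: (leqP (size s) (size s')) => [|/ltnW] /W; [|rewrite orbC]; apply.
have -> : s' = s ++ drop (size s) s'.
  by rewrite {1}es -(take_takel _ le) -es' cat_take_drop.
by rewrite node_cat.
Qed.

Lemma forest_hit n (f : {set 'I_n} -> {set 'I_N}) : k = N - n ->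
  (forall A B, (f A \subset f B) = (A \subset B)) -> exists S, forest (f S).
Proof.
move=> kE fm; apply: contrapT => nhit.
have /fin_all_exists[x xP] i : exists z, z \in f [set i] :\: f (~: [set i]).
  apply/set0Pn; rewrite setD_eq0 fm; apply/negP => /subsetP/(_ i).
  by rewrite !inE eqxx => /(_ isT).
have xE i S : (x i \in f S) = (i \in S).
  have := xP i; rewrite inE => /andP[xN x1]; apply/idP/idP => [|iS].
    by apply: contraLR => iS; apply: contraNN xN; apply/subsetP; rewrite fm subsetC sub1set inE.
  by apply: (subsetP _ _ x1); rewrite fm sub1set.
have xinj : injective x.
  by move=> i i' e; have := xE i [set i']; rewrite e xE !inE eqxx => /esym/eqP.
pose Y := ~: (x @: setT).
have cY : #|Y| = k.
  by have := cardsC (x @: setT); rewrite card_imset // cardsT !card_ord -/Y; lia.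
pose trace s := [set i | x i \in node Y s].
(* The invariant [{subset s <= f (trace s)}] survives each extension because [trace] and [f] are
   monotone. *)
have walk l : exists s, [/\ size s = l, uniq s, {subset s <= Y}
                        & {subset s <= f (trace s)}].
  elim: l => [|l [s [sl us sY sf]]]; first by exists [::].
  have [y /and3P[yY yf ys]] : exists y, [&& y \in Y, y \in f (trace s) & y \notin s].
    apply/existsP; apply: contrapT => /negP; rewrite negb_exists => /forallP nex.
    (* With no new point of [Y] available, [f (trace s)] and [node Y s] agree on [Y]; off [Y] they
       agree by the choice of [trace s]. *)
    apply: nhit; exists (trace s), Y, s; split => //; apply/setP => z.
    case: (boolP (z \in Y)) => [zY|]; last first.
      by rewrite inE negbK => /imsetP[i _ ->]; rewrite xE inE.
    rewrite node_base //; apply/idP/idP => [zf|/sf//].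
    by have := nex z; rewrite zY zf /= negbK.
  exists (rcons s y); rewrite size_rcons sl rcons_uniq us ys; split => //.
    by move=> z; rewrite mem_rcons inE => /predU1P[->//|/sY].
  have tsub : f (trace s) \subset f (trace (rcons s y)).
    rewrite fm; apply/subsetP => i; rewrite -cats1 [i \in trace s]in_set [i \in trace _]in_set.
    exact: (subsetP (node_cat _ _ _)).
  move=> z; rewrite mem_rcons inE => /predU1P[->|/sf]; exact: (subsetP tsub).
have [s [sk us sY _]] := walk k.+1.
have /(uniq_leq_size us) : {subset s <= enum Y} by move=> z; rewrite mem_enum; exact: sY.
by rewrite -cardE cY sk ltnn.
Qed.

End Forest.

(** With [k = N - n], the codewords take [6 * k * m] points, the blocks [2 * k * m] more, and [Y]
    itself [k]: this is the room required. *)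
Lemma exists_forest n N m :
  0 < m -> N <= 2 ^ m -> 8 * (N - n) * m + (N - n) <= N ->
  exists F : {set 'I_N} -> Prop,
    (forall A B C, F A -> F B -> F C -> A \subset C -> B \subset C ->
       (A \subset B) || (B \subset A)) /\
    (forall f : {set 'I_n} -> {set 'I_N},
       (forall A B, (f A \subset f B) = (A \subset B)) -> exists S, F (f S)).
Proof.
move=> m0 Nm; set k := N - n => room.
have [||w wP] := @separating_words 'I_N k m m0; [by rewrite card_ord|nia|].
have [|b b_inj] := @exists_inj 'I_N {ffun 'I_m -> bool}.
  by rewrite card_ffun card_bool !card_ord.
have [|e1 e1_inj] := @exists_inj ('I_(3 * k) * ('I_m * bool))%type 'I_N.
  by rewrite !card_prod card_bool !card_ord; nia.
have /fin_all_exists[e2 e2P] (Y : {set 'I_N}) :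
    exists e : 'I_k * ('I_m * bool) -> 'I_N, #|Y| = k ->
      injective e /\ forall x, e x \in ~: (Y :|: e1 @: setT).
  case: (eqVneq #|Y| k) => [cY|neq]; last first.
    have [|e _] := @exists_inj ('I_k * ('I_m * bool))%type 'I_N.
      by rewrite !card_prod card_bool !card_ord; nia.
    by exists e => cY; rewrite cY eqxx in neq.
  have [|e ei eP] := @exists_inj_in ('I_k * ('I_m * bool))%type _ (~: (Y :|: e1 @: setT)).
    have := (leq_card_setU Y (e1 @: setT)).1; have := cardsC (Y :|: e1 @: setT).
    rewrite cY (card_imset _ e1_inj) cardsT !card_prod card_bool !card_ord.
    by move: #|Y :|: _| #|~: _| => a a'; lia.
  by exists e.
exists (forest w b e1 e2); split.
  apply: forest_down => //.
  - by move=> Y cY; case: (e2P Y cY).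
  - by move=> Y x cY; case: (e2P Y cY) => _ /(_ x); rewrite !inE => /norP[].
  - move=> Y x y cY; case: (e2P Y cY) => _ /(_ x); rewrite !inE => /norP[_].
    by apply: contraNneq => ->; rewrite imset_f.
move=> f fm; apply: (@forest_hit _ _ _ m0 w b e1 e2 _ n) => //.
by move=> Y x cY; case: (e2P Y cY) => _ /(_ x); rewrite !inE => /norP[].
Qed.

(** * The numerical estimate *)

Section Estimate.
Local Open Scope ring_scope.
Import GRing.Theory Num.Theory.

Lemma log2_pow2_le (R : realType) (n l : nat) :
  (0 < n)%N -> (2 ^ l <= n)%N -> l%:R <= log2 n%:R :> R.
Proof.
move=> n0 ln2; have ln2_gt0 : 0 < ln (2 : R) by rewrite ln_gt0 // ltr1n.
rewrite /log2 ler_pdivlMr // mulr_natl -lnXn ?ltr0n //.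
by rewrite ler_ln ?posrE ?exprn_gt0 ?ltr0n // -natrX ler_nat.
Qed.

Lemma room_estimate (R : realType) (n N : nat) : (8 < n)%N ->
  N%:R < n%:R + 1 / 15%:R * (n%:R / log2 n%:R) :> R ->
  exists2 m, (0 < m)%N & (N <= 2 ^ m)%N && (8 * (N - n) * m + (N - n) <= N)%N.
Proof.
move=> n8 ltN; case: (leqP N n) => [Nn|nN].
  exists N.+1 => //; rewrite (eqP (Nn : N - n == 0)%N) muln0 mul0n leq0n andbT.
  exact/ltnW/(ltn_trans (ltnSn N))/ltn_expl.
have n0 : (0 < n)%N by lia.
have [L1 L2] : (2 ^ trunc_log 2 n <= n /\ n < 2 ^ (trunc_log 2 n).+1)%N.
  by split; [exact: trunc_logP|exact: trunc_log_ltn].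
move: (trunc_log 2 n) L1 L2 => l L1 L2.
(* With [k = N - n], [3 <= l] gives [8 * k * (l + 2) + k <= 15 * k * l], whence the constant 15. *)
have l3 : (3 <= l)%N by rewrite -ltnS -(ltn_exp2l _ _ (isT : 1 < 2)%N); apply: leq_ltn_trans L2; lia.
have lel := log2_pow2_le R n0 L1.
have log_gt0 : 0 < log2 n%:R :> R by apply: lt_le_trans lel; rewrite ltr0n; lia.
have lt15 : (15 * (N - n) * l < n)%N.
  rewrite -(ltr_nat R) !natrM natrB ?(ltnW nN) //.
  apply: le_lt_trans (_ : 15 * (N%:R - n%:R) * log2 n%:R < _).
    by rewrite ler_wpM2l // mulr_ge0 // subr_ge0 ler_nat ltnW.
  rewrite -ltr_pdivlMr // -ltr_pdivlMl // ltrBlDl.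
  by rewrite div1r in ltN.
(* The exponent is [l + 2] because [N < 2 * n] and [n < 2 ^ (l + 1)]. *)
exists l.+2 => //; apply/andP; split; last by nia.
rewrite expnS; nia.
Qed.

End Estimate.

(** * Both bounds combined *)

Local Open Scope ring_scope.

Theorem theorem2 (R : realType) (d : Order.disp_t) (P : finPOrderType d) :
  exists (fP n0 : nat), forall n : nat, (n0 < n)%N ->
    (contains_copy Lambda_poset P || contains_copy V_poset P ->
      n%:R + 1 / 15%:R * (n%:R / log2 n%:R) <= (poset_ramsey P (Qn n))%:R :> R) /\
    (~~ contains_copy Lambda_poset P && ~~ contains_copy V_poset P ->
      (poset_ramsey P (Qn n) <= n + fP)%N).
Proof.
exists (#|{set P}| + #|P|)%N, 8%N => n n8; split; last first.
  case/andP=> nL nV; rewrite /poset_ramsey; case: ex_minnP => N _; apply.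
  exact: arrow_parallel_chains.
move=> LV; rewrite leNgt; apply/negP => /(room_estimate n8)[m m0 /andP[Nm]].
rewrite /poset_ramsey in Nm *; case: ex_minnP Nm => N /ramsey_arrowP arrow _ Nm.
case/(exists_forest m0 Nm) => F [Fdown Fhit].
case/orP: LV => [/contains_LambdaP|/contains_VP] [u [v [w [uw vw]]]]; apply/negP; rewrite negbK.
  (* A blue copy of [P] would put the incomparable [f u] and [f v] below [f w] in the forest; a red
     [Q_n] would miss the forest. *)
  have [[f fm fF]|[f fm fF]] := arrow (fun A => `[< F A >]).
    rewrite /Order.comparable -!fm; apply: (Fdown _ _ (f w)); rewrite ?fm //; exact/asboolP.
  by have [S FS] := Fhit f fm; have /asboolP := fF S.
have [[f fm fF]|[f fm fF]] := arrow (fun A => `[< F (~: A) >]).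
  rewrite /Order.comparable -!fm -setCS -[f v \subset _]setCS.
  by apply: (Fdown _ _ (~: f w)); rewrite ?setCS ?fm //; apply/asboolP.
(* Conjugating by complements turns the red embedding into one that misses [F]. *)
have [|S FS] := Fhit (fun S => ~: f (~: S)).
  by move=> A B; rewrite setCS fm; exact: setCS.
by have /asboolP := fF (~: S).
Qed.
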